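(* Any deterministic online algorithm for online MinLA that always moves to a feasible permutation with the lowest distance to $\pi_0$ is no better than $\Omega(n)$-competitive. That is, for each of the two classes of instances (line instances and clique instances) there are constants $\gamma>0$ and $n_0$ such that for every $n\ge n_0$: if a deterministic online algorithm on $n$ nodes always chooses, upon the reveal of $G_i$, a permutation $\pi_i$ that minimizes $d(\pi_0,\pi)$ among all MinLAs $\pi$ of $G_i$ (with an arbitrary tie-breaking rule), and this algorithm is $c$-competitive on the instances of the class with $n$ nodes, then $c\ge\gamma n$.
   Context: Let $V$ be a set of $n$ nodes. A permutation is a bijection $\pi:V\to\{1,\dots,n\}$. A MinLA of a graph $G=(V,E)$ is a permutation $\pi$ minimizing $\sum_{\{x,y\}\in E}|\pi(x)-\pi(y)|$ among all permutations. $d(\pi,\pi')$ is the Kendall tau distance: the minimum number of swaps of adjacent elements transforming $\pi$ into $\pi'$. An instance consists of an initial permutation $\pi_0$ and a sequence $G_0,\dots,G_k$ of graphs on $V$ where $G_0$ has no edges. In a clique instance, every $G_i$ is a disjoint union of cliques (isolated nodes are cliques of size one) and $G_{i+1}$ is obtained from $G_i$ by merging exactly two cliques into one. In a line instance, every $G_i$ is a disjoint union of paths (isolated nodes are paths with one node) and $G_{i+1}$ is obtained from $G_i$ by adding one edge between two distinct components. Feasible solution: permutations $\pi_1,\dots,\pi_k$ such that $\pi_i$ is a MinLA of $G_i$ for each $i$ (''feasible permutation'' upon the reveal of $G_i$ means a MinLA of $G_i$); its cost is $\sum_{i=0}^{k-1}d(\pi_i,\pi_{i+1})$. A deterministic online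 algorithm chooses $\pi_i$ as a function of $\pi_0,G_0,\dots,G_i$ only. $\mathrm{Opt}(\sigma)$ is the minimum cost of a feasible solution of the instance $\sigma$. A deterministic algorithm is $c$-competitive if its cost on every instance $\sigma$ is at most $c\cdot\mathrm{Opt}(\sigma)$. *)

(* Defs.v *)
From HB Require Import structures.
From mathcomp Require Import all_boot all_order all_fingroup all_algebra.
From mathcomp Require Import reals.
From mathcomp Require Import zify.

Set Implicit Arguments.
Unset Strict Implicit.
Unset Printing Implicit Defensive.

(* Positions are numbered 0, ..., n-1 rather than 1, ..., n; only differences
   of positions are ever used.  Injectivity is enough for bijectivity, by
   cardinality: see [layout_bij]. *)
Record layout (V : finType) := Layout {
  layout_ffun :> {ffun V -> 'I_#|V|};
  layout_injb : injectiveb layout_ffun }.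

HB.instance Definition _ (V : finType) := [isSub for @layout_ffun V].
HB.instance Definition _ (V : finType) := [Finite of layout V by <:].

Lemma layout_inj (V : finType) (p : layout V) : injective p.
Proof. exact/injectiveP/layout_injb. Qed.

Lemma layout_bij (V : finType) (p : layout V) : bijective p.
Proof. by apply: inj_card_bij (@layout_inj _ p) _; rewrite card_ord. Qed.

Definition adjacent_swap (V : finType) (p q : layout V) : bool :=
  [exists x, exists y,
    (p y == (p x).+1 :> nat) && [forall z, q z == p (tperm x y z)]].

Definition reachable_in (V : finType) (p q : layout V) (m : nat) : bool :=
  [exists s : m.-tuple (layout V),
    path (@adjacent_swap V) p s && (last p s == q)].

Section Reachability.
Variable V : finType.
Implicit Types p q : layout V.

Let swap_injb p x y : injectiveb [ffun z => p (tperm x y z)].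
Proof.
by apply/injectiveP => u v; rewrite !ffunE => /layout_inj /perm_inj.
Qed.

Let swap p x y : layout V := Layout (swap_injb p x y).

Let swapP p x y :
  p y = (p x).+1 :> nat -> adjacent_swap p (swap p x y).
Proof.
move=> e; apply/existsP; exists x; apply/existsP; exists y.
by rewrite e eqxx; apply/forallP => z; rewrite ffunE.
Qed.

Let pot p q := \sum_(z : V) p z * q z.

Let pot_swap p q x y : p y = (p x).+1 :> nat -> q y < q x ->
  pot p q < pot (swap p x y) q.
Proof.
move=> e lt; have nxy : y != x by apply/eqP => E; move: lt; rewrite E ltnn.
rewrite /pot (bigD1 x) //= (bigD1 y) //= [X in _ < X](bigD1 x) //=.
rewrite [X in _ < _ + X](bigD1 y) //= !ffunE tpermL tpermR.
rewrite [X in _ < _ + (_ + X)](eq_bigr (fun z => p z * q z)); last first.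
  by move=> z /andP[zx zy]; rewrite ffunE tpermD // eq_sym.
rewrite e !mulSn [X in _ < X + _]addnC -!addnA ltn_add2l !addnA.
by rewrite !ltn_add2r.
Qed.

Let pot_le p q : pot p q <= #|V| * (#|V| * #|V|).
Proof.
rewrite -[X in _ <= X * _]sum1_card big_distrl /=.
by apply: leq_sum => z _; rewrite mul1n leq_mul // ltnW.
Qed.

Let sorted_eq p q :
  (forall x y, p y = (p x).+1 :> nat -> q x < q y) -> p = q.
Proof.
move=> H; have [g pK gK] := layout_bij p.
have mono k (i j : 'I_#|V|) : j = i + k.+1 :> nat -> q (g i) + k < q (g j).
  elim: k j => [|k IH] j ej; first by rewrite addn0; apply: H; rewrite !gK; lia.
  have lt : i + k.+1 < #|V| by have := ltn_ord j; lia.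
  have := IH (Ordinal lt) erefl.
  have : q (g (Ordinal lt)) < q (g j) by apply: H; rewrite !gK /= ej addnS.
  lia.
apply: val_inj; apply/ffunP => z; apply: val_inj => /=.
have n0 : 0 < #|V| by have := ltn_ord (p z); lia.
have n1 : #|V|.-1 < #|V| by lia.
have ge : p z <= q z.
  case: (posnP (p z)) => [->//|pz].
  have := mono (p z).-1 (Ordinal n0) (p z); rewrite pK add0n prednK // => /(_ erefl).
  lia.
have le : q z <= p z.
  have [e|ne] := eqVneq (p z : nat) #|V|.-1; first by have := ltn_ord (q z); lia.
  have arith a b c d :
    a < d -> c < d -> c != d.-1 -> b + (d.-1 - c).-1 < a -> b <= c by lia.
  have e : #|V|.-1 = p z + (#|V|.-1 - p z).-1.+1 by have := ltn_ord (p z); lia.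
  have := mono (#|V|.-1 - p z).-1 (p z) (Ordinal n1) e; rewrite pK.
  exact: arith (ltn_ord _) (ltn_ord _) ne.
by apply/eqP; rewrite eqn_leq ge le.
Qed.

Lemma reachable p q : exists m, reachable_in p q m.
Proof.
have [k] := ubnP (#|V| * (#|V| * #|V|) - pot p q).
elim: k p => // k IH p lek.
have [/existsP[x /existsP[y /andP[/eqP e lt]]]|none] :=
  boolP [exists x, exists y, (p y == (p x).+1 :> nat) && (q y < q x)].
  have [|m /existsP[s /andP[ps ls]]] := IH (swap p x y).
    by have := pot_swap e lt; have := pot_le (swap p x y) q; lia.
  exists m.+1; apply/existsP; exists [tuple of swap p x y :: s].
  by rewrite /= swapP //= ps ls.
exists 0; apply/existsP; exists [tuple]; rewrite /=; apply/eqP/sorted_eq => x y e.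
move: none => /existsPn/(_ x)/existsPn/(_ y); rewrite e eqxx /= -leqNgt.
rewrite leq_eqVlt => /orP[/eqP/val_inj/layout_inj E|//].
by move: e; rewrite E; lia.
Qed.
End Reachability.

Definition kendall_tau (V : finType) (p q : layout V) : nat :=
  ex_minn (reachable p q).

Record graph (V : finType) := Graph {
  edges :> {set {set V}};
  edges_card2 : [forall e in edges, #|e| == 2] }.

HB.instance Definition _ (V : finType) := [isSub for @edges V].
HB.instance Definition _ (V : finType) := [Finite of graph V by <:].

Definition adj (V : finType) (G : graph V) : rel V :=
  fun x y => [set x; y] \in edges G.

Definition component (V : finType) (G : graph V) (x : V) : {set V} :=
  [set y | connect (adj G) x y].

(* The condition [p x < p y] lists each edge exactly once, so the truncated
   difference is the distance between the positions of its endpoints. *)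
Definition arrangement_cost (V : finType) (G : graph V) (p : layout V) : nat :=
  \sum_(x : V) \sum_(y : V | adj G x y && (p x < p y)) (p y - p x).

Definition minLA (V : finType) (G : graph V) (p : layout V) : bool :=
  [forall q : layout V, arrangement_cost G p <= arrangement_cost G q].

Definition disjoint_cliques (V : finType) (G : graph V) : Prop :=
  forall x y, x != y -> y \in component G x -> adj G x y.

(* The component of [x] is enumerated by [s] in the order of the path. *)
Definition disjoint_paths (V : finType) (G : graph V) : Prop :=
  forall x, exists s : seq V,
    [/\ uniq s, s =i component G x
      & {in s &, forall u v, adj G u v =
          (index v s == (index u s).+1) || (index u s == (index v s).+1)}].

Definition merges_two_cliques (V : finType) (G H : graph V) : Prop :=
  exists x y, y \notin component G x /\
    edges H = edges G :|:
      [set [set u; v] | u in component G x, v in component G y].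

Definition adds_one_edge (V : finType) (G H : graph V) : Prop :=
  exists x y, y \notin component G x /\ edges H = [set x; y] |: edges G.

(* Only the graphs [reveal 0], ..., [reveal len] belong to the instance; the
   later values of [reveal] are never inspected. *)
Record instance (V : finType) := Instance {
  init : layout V;
  len : nat;
  reveal : nat -> graph V }.

Inductive instance_class := LineInstances | CliqueInstances.

Definition in_class (C : instance_class) (V : finType) (I : instance V) : Prop :=
  let shape := match C with
    | LineInstances => @disjoint_paths V
    | CliqueInstances => @disjoint_cliques V end in
  let step := match C with
    | LineInstances => @adds_one_edge V
    | CliqueInstances => @merges_two_cliques V end in
  [/\ edges (reveal I 0) = set0,
      forall i, i <= len I -> shape (reveal I i)
    & forall i, i < len I -> step (reveal I i) (reveal I i.+1)].

(* The tuple [s] lists the layouts number 1, ..., k; the initial one is not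
   part of it, so [tnth s i] answers the graph number [i.+1]. *)
Definition feasible (V : finType) (I : instance V)
    (s : (len I).-tuple (layout V)) : bool :=
  [forall i : 'I_(len I), minLA (reveal I i.+1) (tnth s i)].

Definition solution_cost (V : finType) (I : instance V)
    (s : (len I).-tuple (layout V)) : nat :=
  \sum_(i < len I) kendall_tau (nth (init I) (init I :: s) i) (tnth s i).

Lemma feasible_cost_exists (V : finType) (I : instance V) :
  exists m, [exists s : (len I).-tuple (layout V),
    feasible s && (solution_cost s == m)].
Proof.
pose best i := [arg min_(p < init I) arrangement_cost (reveal I i) p].
pose s := [tuple best (nat_of_ord i).+1 | i < len I].
exists (solution_cost s); apply/existsP; exists s; rewrite eqxx andbT.
apply/forallP => i; rewrite tnth_mktuple /best.
by case: arg_minnP => // p _ minp; apply/forallP => q; apply: minp.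
Qed.

Definition opt (V : finType) (I : instance V) : nat :=
  ex_minn (feasible_cost_exists I).

(* The answer to the graph number i is computed from the initial layout and
   the sequence of the graphs number 0, ..., i. *)
Definition online_algorithm (V : finType) : Type :=
  layout V -> seq (graph V) -> layout V.

Definition run (V : finType) (A : online_algorithm V) (I : instance V) :
    (len I).-tuple (layout V) :=
  [tuple A (init I) (mkseq (reveal I) (nat_of_ord i).+2) | i < len I].

Definition always_closest_to_init (C : instance_class) (V : finType)
    (A : online_algorithm V) : Prop :=
  forall I : instance V, in_class C I -> forall i : 'I_(len I),
    minLA (reveal I i.+1) (tnth (run A I) i) /\
    forall q : layout V, minLA (reveal I i.+1) q ->
      kendall_tau (init I) (tnth (run A I) i) <= kendall_tau (init I) q.

Definition competitive (R : realType) (C : instance_class) (V : finType)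
    (c : R) (A : online_algorithm V) : Prop :=
  forall I : instance V, in_class C I ->
    ((solution_cost (run A I))%:R <= c * (opt I)%:R)%R.

(* Main.v *)
Require Import Defs.
From mathcomp Require Import all_boot all_order all_fingroup all_algebra.
From mathcomp Require Import reals.
From mathcomp Require Import zify.

(** The Kendall tau distance counts inversions.  Cut the initial layout into
    consecutive blocks L, M, R with |L| = |R| = m = n %/ 3.  The adversary
    reveals a growing clique (or path) S made of a nodes at the end of L and b
    nodes at the start of R, so that every MinLA keeps S contiguous.  A node of
    M then has at least a inversions when it is placed before S and at least b
    when it is placed after S, and some MinLA attains min a b for all of M at
    once: a closest MinLA puts all of M on the side dictated by the sign of
    a - b.  Growing S so that this sign alternates forces M to cross S each
    time, at a total cost of (m-1)^2 |M|, whereas moving once to the order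
    L, R, M costs m |M| and stays optimal for every graph. *)

Set Implicit Arguments.
Unset Strict Implicit.
Unset Printing Implicit Defensive.

(* [lia] only recognizes occurrences of a position as the same atom when
   their implicit arguments agree syntactically, which the layout coercion
   does not ensure. *)
Definition pos (V : finType) (p : layout V) (x : V) : nat := p x.

(** * Kendall tau distance and inversions *)

Section Inversions.
Variable V : finType.
Implicit Types p q r : layout V.

Lemma pos_eq p x y : (pos p x == pos p y) = (x == y).
Proof. by rewrite (inj_eq val_inj) (inj_eq (@layout_inj _ p)). Qed.

Lemma pos_inj p x y : pos p x = pos p y -> x = y.
Proof. by move=> /val_inj/layout_inj. Qed.

Lemma pos_ltn p x : pos p x < #|V|.
Proof. exact: ltn_ord. Qed.

Lemma layout_ext p q : pos p =1 pos q -> p = q.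
Proof. by move=> H; apply/val_inj/ffunP => z; apply/val_inj/H. Qed.

Lemma layout_at p k : k < #|V| -> exists x, pos p x = k.
Proof.
move=> lt; have [g _ gK] := layout_bij p; exists (g (Ordinal lt)).
by rewrite /pos gK.
Qed.

Lemma card_pos_between p a b :
  b <= #|V| -> #|[set x | a <= pos p x < b]| = b - a.
Proof.
move=> bn; rewrite -[RHS](size_iota a) cardE -(size_map (pos p)).
apply/perm_size/uniq_perm; last 1 first.
- move=> k; rewrite mem_iota; apply/mapP/idP => [[x]|H].
    by rewrite mem_enum inE => + ->; lia.
  have [|x xk] := @layout_at p k; first lia.
  by exists x => //; rewrite mem_enum inE xk; lia.
- by rewrite map_inj_uniq ?enum_uniq //; exact: pos_inj.
- exact: iota_uniq.
Qed.

Definition inversion_set p q :=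
  [set u : V * V | (pos p u.1 < pos p u.2) && (pos q u.2 < pos q u.1)].
Definition inversions p q := #|inversion_set p q|.

(** The order of the two nodes in [q] decides which of the two steps inverts a pair inverted from
    [p] to [r]. *)
Lemma inversions_triangle p q r :
  inversions p r <= inversions p q + inversions q r.
Proof.
apply: leq_trans (leq_card_setU _ _); apply/subset_leq_card/subsetP => -[u v].
rewrite !inE /= => /andP[puv ->]; rewrite puv andbT /=.
have := pos_eq q u v; case: (eqVneq u v) puv => [->|_]; lia.
Qed.

(** Without inversions both layouts induce the same order, and a position is the number of nodes
    placed before it. *)
Lemma inversions_eq0 p q : inversions p q = 0 -> p = q.
Proof.
move=> /eqP; rewrite cards_eq0 => /eqP E.
have mono x y : pos p x < pos p y -> pos q x < pos q y.
  move=> lt; move/setP: E => /(_ (x, y)); rewrite !inE /= lt /=.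
  by have := pos_eq q x y; case: (eqVneq x y) lt => [->|_]; lia.
have mono' x y : (pos p x < pos p y) = (pos q x < pos q y).
  apply/idP/idP; first exact: mono.
  have := @mono y x; have := pos_eq p x y; case: (eqVneq x y) => [->|_]; lia.
apply: layout_ext => z.
have := card_pos_between p 0 (ltnW (pos_ltn p z)).
have := card_pos_between q 0 (ltnW (pos_ltn q z)).
by rewrite !subn0 => <- <-; apply: eq_card => x; rewrite !inE; exact: mono'.
Qed.

Lemma inversions_self p : inversions p p = 0.
Proof. by apply/eqP; rewrite cards_eq0; apply/eqP/setP => u; rewrite !inE; lia. Qed.

Lemma adjacent_swapP p q : reflect
  (exists x y, pos p y = (pos p x).+1 /\ forall z, pos q z = pos p (tperm x y z))
  (adjacent_swap p q).
Proof.
apply: (iffP existsP) => [[x /existsP[y /andP[/eqP e /forallP H]]]|].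
  by exists x, y; split=> // z; rewrite /pos (eqP (H z)).
move=> [x [y [e H]]]; exists x; apply/existsP; exists y; apply/andP; split.
  exact/eqP.
by apply/forallP => z; apply/eqP/val_inj/H.
Qed.

Lemma inversions_adjacent_swap p q : adjacent_swap p q -> inversions p q <= 1.
Proof.
move=> /adjacent_swapP[x [y [e H]]].
rewrite -(cards1 (x, y)); apply/subset_leq_card/subsetP => -[u v].
rewrite !inE /= !H xpair_eqE.
have := pos_eq p u x; have := pos_eq p v x.
have := pos_eq p u y; have := pos_eq p v y.
by case: tpermP => [->|->|_ _]; case: tpermP => [->|->|_ _]; rewrite ?eqxx; lia.
Qed.

Lemma inversions_le_reachable p q m : reachable_in p q m -> inversions p q <= m.
Proof.
move=> /existsP[[s /= /eqP <-]] /andP[].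
elim: s p => [|r s IH] p /=; first by move=> _ /eqP->; rewrite inversions_self.
move=> /andP[pr rs] l; apply: leq_trans (inversions_triangle p r q) _.
by rewrite -add1n leq_add ?IH ?inversions_adjacent_swap.
Qed.

(** If [q] kept the order of all nodes adjacent in [p], then by induction on the distance in [p] no
    pair at all would be inverted. *)
Lemma adjacent_inversion p q : p != q ->
  exists x y, pos p y = (pos p x).+1 /\ pos q y < pos q x.
Proof.
move=> npq.
have [/existsP[x /existsP[y /andP[/eqP e lt]]]|none] :=
  boolP [exists x, exists y, (pos p y == (pos p x).+1) && (pos q y < pos q x)].
  by exists x, y.
case/eqP: npq; apply: inversions_eq0; apply/eqP; rewrite cards_eq0.
apply/eqP/setP => -[u v]; rewrite !inE /=; apply/negP => /andP[].
have [k] := ubnP (pos p v - pos p u).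
elim: k u v => // k IH u v luv puv quv.
have [|w pw] := @layout_at p (pos p u).+1; first by have := pos_ltn p v; lia.
have quw : pos q u <= pos q w.
  move: none => /existsPn/(_ u)/existsPn/(_ w).
  by rewrite pw eqxx /=; lia.
have := pos_eq p w v; case: (eqVneq w v) => [E|_ /eqP nwv].
  by move: quw quv; rewrite E; lia.
by apply: (IH w v); lia.
Qed.

Lemma swap_injb p x y : injectiveb [ffun z => p (tperm x y z)].
Proof.
by apply/injectiveP => u v; rewrite !ffunE => /layout_inj /perm_inj.
Qed.

Definition swap p x y : layout V := Layout (swap_injb p x y).

Lemma pos_swap p x y z : pos (swap p x y) z = pos p (tperm x y z).
Proof. by rewrite /pos ffunE. Qed.

Lemma inversions_swap p q x y : pos p y = (pos p x).+1 -> pos q y < pos q x ->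
  inversions (swap p x y) q < inversions p q.
Proof.
move=> e lt; apply/proper_card/properP; split; last first.
  by exists (x, y); rewrite !inE /= ?pos_swap ?tpermL ?tpermR; lia.
apply/subsetP => -[u v]; rewrite !inE /= !pos_swap.
have := pos_eq p u x; have := pos_eq p v x.
have := pos_eq p u y; have := pos_eq p v y.
case: tpermP => [->|->|/eqP/negbTE-> /eqP/negbTE->];
  by case: tpermP => [->|->|/eqP/negbTE-> /eqP/negbTE->]; rewrite ?eqxx; lia.
Qed.

(** Bubble sort: as long as [p] differs from [q], swapping an inverted adjacent pair lowers the
    inversion count. *)
Lemma reachable_inversions p q :
  exists2 m, m <= inversions p q & reachable_in p q m.
Proof.
have [k] := ubnP (inversions p q); elim: k p => // k IH p lek.
have [->|/adjacent_inversion[x [y [e lt]]]] := eqVneq p q.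
  by exists 0 => //; apply/existsP; exists [tuple] => /=.
have lt' := inversions_swap e lt.
have [|m lem /existsP[s /andP[ps ls]]] := IH (swap p x y); first lia.
exists m.+1; first lia.
apply/existsP; exists [tuple of swap p x y :: s]; rewrite /= ps ls !andbT.
by apply/adjacent_swapP; exists x, y; split=> // z; rewrite pos_swap.
Qed.

Lemma kendall_tauE p q : kendall_tau p q = inversions p q.
Proof.
rewrite /kendall_tau; case: ex_minnP => m /inversions_le_reachable lem minm.
have [k lek /minm] := reachable_inversions p q; lia.
Qed.

(** Lower bound for moving [A] across [B]: a pair counts if its order changes in either direction,
    and disjointness makes each unordered pair count only once. *)
Lemma inversions_disjoint p q (A B : {set V}) : [disjoint A & B] ->
  \sum_(x in A) #|[set y in B | (pos p x < pos p y) != (pos q x < pos q y)]|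
    <= inversions p q.
Proof.
move=> dAB.
pose i x y := (pos p x < pos p y) && (pos q y < pos q x).
(* [w] selects the ordered pairs with one node in each set, in both orientations; it is at most 1 by
   disjointness. *)
pose w x y := ((x \in A) && (y \in B)) + ((y \in A) && (x \in B)).
have -> : inversions p q = \sum_x \sum_y i x y.
  rewrite /inversions -sum1_card pair_big /= [LHS]big_mkcond /=.
  by apply: eq_bigr => -[x y] _; rewrite !inE /i /=; case: ifP.
apply: (@leq_trans (\sum_x \sum_y w x y * i x y)); last first.
  apply: leq_sum => x _; apply: leq_sum => y _.
  rewrite -[X in _ <= X]mul1n leq_mul2r; apply/orP; right; rewrite /w.
  case: (boolP (x \in A)) => [xA|_]; last by rewrite /= add0n leq_b1.
  by rewrite (disjointFr dAB xA) andbF addn0; exact: leq_b1.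
have -> : \sum_x \sum_y w x y * i x y =
    \sum_x \sum_y ((x \in A) && (y \in B)) * (i x y + i y x).
  under eq_bigr do under eq_bigr do rewrite mulnDl.
  under eq_bigr do rewrite big_split.
  rewrite big_split /= [X in _ + X]exchange_big /= -big_split /=.
  apply: eq_bigr => x _; rewrite -big_split /=; apply: eq_bigr => y _.
  by rewrite mulnDr.
rewrite big_mkcond /=; apply: leq_sum => x _; case: ifP => // xA.
rewrite -sum1_card big_mkcond /=; apply: leq_sum => y _; rewrite !inE.
case: (boolP (y \in B)) => //= yB; rewrite mul1n /i.
have nxy : x != y by apply: contraTneq yB => <-; rewrite (disjointFr dAB xA).
have := pos_eq p x y; have := pos_eq q x y; rewrite (negbTE nxy).
by case: ifP; lia.
Qed.

End Inversions.

(** * Cliques and paths on an interval of positions *)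

Section Intervals.
Variables (V : finType) (k : layout V).
Implicit Types p : layout V.

Definition block lo hi : {set V} := [set x | lo <= pos k x <= hi].

(** The layout [k] serves as a template: the graph is the clique on an interval of [k], or the path
    visiting that interval in the order of [k]. *)
Definition linked C lo hi : rel V := fun x y =>
  [&& x \in block lo hi, y \in block lo hi &
    match C with
    | LineInstances =>
        (pos k y == (pos k x).+1) || (pos k x == (pos k y).+1)
    | CliqueInstances => x != y
    end].

Lemma linked_sym C lo hi x y : linked C lo hi x y = linked C lo hi y x.
Proof.
rewrite /linked andbCA; congr [&& _, _ & _].
by case: C; [rewrite orbC | rewrite eq_sym].
Qed.

Lemma linked_neq C lo hi x y : linked C lo hi x y -> x != y.
Proof.
case/and3P => _ _; case: C => // H; apply: contraTneq H => ->; lia.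
Qed.

Lemma linked_succ C lo hi x y : x \in block lo hi -> y \in block lo hi ->
  pos k y = (pos k x).+1 -> linked C lo hi x y.
Proof.
rewrite /linked => -> -> e /=; case: C; first by rewrite e eqxx.
by rewrite -(pos_eq k) e; lia.
Qed.

Definition interval_edges C lo hi : {set {set V}} :=
  [set e | [exists x, exists y, linked C lo hi x y && (e == [set x; y])]].

Lemma interval_edgesP C lo hi e : reflect
  (exists x y, linked C lo hi x y /\ e = [set x; y]) (e \in interval_edges C lo hi).
Proof.
rewrite inE; apply: (iffP existsP) => [[x /existsP[y /andP[xy /eqP->]]]|].
  by exists x, y.
by move=> [x [y [xy ->]]]; exists x; apply/existsP; exists y; rewrite xy eqxx.
Qed.

Lemma interval_edges_card2 C lo hi :
  [forall e in interval_edges C lo hi, #|e| == 2].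
Proof.
apply/forall_inP => e /interval_edgesP[x [y [/linked_neq xy ->]]].
by rewrite cards2 xy.
Qed.

Definition interval_graph C lo hi : graph V :=
  Graph (interval_edges_card2 C lo hi).

Lemma set2_eq (x y u v : V) : [set x; y] = [set u; v] ->
  (x = u /\ y = v) \/ (x = v /\ y = u).
Proof.
move=> E.
have /set2P Hx : x \in [set u; v] by rewrite -E set21.
have /set2P Hy : y \in [set u; v] by rewrite -E set22.
have /set2P Hu : u \in [set x; y] by rewrite E set21.
have /set2P Hv : v \in [set x; y] by rewrite E set22.
by intuition congruence.
Qed.

Lemma adj_interval C lo hi x y :
  adj (interval_graph C lo hi) x y = linked C lo hi x y.
Proof.
apply/interval_edgesP/idP => [[u [v [uv /set2_eq]]]|xy]; last by exists x, y.
by move=> [[-> ->]|[-> ->]]; rewrite // linked_sym.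
Qed.

Lemma connect_interval C lo hi x y : hi < #|V| ->
  x \in block lo hi -> y \in block lo hi ->
  connect (adj (interval_graph C lo hi)) x y.
Proof.
move=> hin; have sym : connect_sym (adj (interval_graph C lo hi)).
  by apply: sym_connect_sym => u v; rewrite !adj_interval linked_sym.
wlog le : x y / pos k x <= pos k y => [W xS yS|].
  have [le|/ltnW le] := leqP (pos k x) (pos k y); first exact: W.
  by rewrite sym; apply: W.
have [n] := ubnP (pos k y - pos k x); elim: n x le => // n IH x le lt xS yS.
have [/eqP|ne] := eqVneq (pos k x) (pos k y); first by rewrite pos_eq => /eqP->.
have [|w pw] := @layout_at _ k (pos k x).+1; first by move: yS; rewrite inE; lia.
have wS : w \in block lo hi by move: xS yS; rewrite !inE pw; lia.
apply: (@connect_trans _ _ w); last by apply: IH => //; lia.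
by apply: connect1; rewrite adj_interval linked_succ.
Qed.

Lemma component_interval C lo hi x y : hi < #|V| ->
  (y \in component (interval_graph C lo hi) x) =
    (x == y) || (x \in block lo hi) && (y \in block lo hi).
Proof.
move=> hin; rewrite inE; apply/idP/orP; last first.
  by move=> [/eqP->//|/andP[xS yS]]; apply: connect_interval.
move=> /connectP[s]; elim: s x => [|z s IH] x /=; first by move=> _ ->; left.
rewrite adj_interval => /andP[/and3P[xS zS _] ps] ly; right; rewrite xS.
by have [/eqP<-|/andP[]] := IH z ps ly.
Qed.

Lemma interval_graph_shape C lo hi : hi < #|V| ->
  match C with
  | LineInstances => @disjoint_paths V
  | CliqueInstances => @disjoint_cliques V
  end (interval_graph C lo hi).
Proof.
move=> hin; case: C => [x|x y xy].
  have [xS|xS] := boolP (x \in block lo hi); last first.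
    exists [:: x]; split => // [y|y z].
      rewrite component_interval // (negbTE xS) orbF inE; exact: eq_sym.
    rewrite !inE => /eqP-> /eqP->; rewrite adj_interval /= eqxx.
    by rewrite /linked (negbTE xS).
  (* [g] inverts [pos k]; [x] is the default for values that are not positions. *)
  pose g i := odflt x [pick y | pos k y == i].
  have gK i : i < #|V| -> pos k (g i) = i.
    rewrite /g; case: pickP => [y /eqP//|none] /(@layout_at _ k)[y yi].
    by have := none y; rewrite yi eqxx.
  have kK y : g (pos k y) = y by apply: (@pos_inj _ k); rewrite gK // pos_ltn.
  pose s := [seq g i | i <- iota lo (hi.+1 - lo)].
  have mem_s y : (y \in s) = (y \in block lo hi).
    apply/mapP/idP => [[i]|yS].
      by rewrite mem_iota inE => H ->; rewrite gK; lia.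
    by exists (pos k y); rewrite ?kK // mem_iota; move: yS; rewrite inE; lia.
  have us : uniq s.
    rewrite map_inj_in_uniq ?iota_uniq // => i j; rewrite !mem_iota => Hi Hj e.
    by rewrite -(gK i) ?e ?gK; lia.
  have index_s y : y \in block lo hi -> index y s = pos k y - lo.
    move=> yS; have lt : pos k y - lo < hi.+1 - lo.
      by move: yS; rewrite inE; lia.
    have E : nth x s (pos k y - lo) = y.
      rewrite (nth_map 0) ?size_iota // nth_iota //.
      by rewrite subnKC ?kK //; move: yS; rewrite inE; lia.
    by rewrite -[in LHS]E index_uniq // size_map size_iota.
  exists s; split=> // [y|u v].
    rewrite component_interval // xS /= mem_s.
    by case: eqP => [<-|//]; rewrite xS.
  rewrite !mem_s => uS vS; rewrite !index_s // adj_interval /linked uS vS /=.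
  by move: uS vS; rewrite !inE; lia.
rewrite component_interval // (negbTE xy) => /andP[xS yS].
by rewrite adj_interval /linked xS yS.
Qed.

(** Growing the interval at either end attaches an isolated node [y]: for paths by the edge to the
    end [x] of the interval, for cliques by the edges to the whole block. *)
Lemma interval_graph_step C lo hi lo' hi' : lo <= hi < #|V| -> hi' < #|V| ->
  (lo' = lo /\ hi' = hi.+1) \/ (lo = lo'.+1 /\ hi' = hi) ->
  match C with
  | LineInstances => @adds_one_edge V
  | CliqueInstances => @merges_two_cliques V
  end (interval_graph C lo hi) (interval_graph C lo' hi').
Proof.
move=> /andP[lohi hin] hin' step.
have [x [y [xS yS xy new S']]] : exists x y, [/\ x \in block lo hi,
    y \notin block lo hi, linked LineInstances lo' hi' x y,
    forall z, z \in block lo hi -> linked LineInstances lo' hi' z y -> z = x &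
    block lo' hi' = y |: block lo hi].
  (* [a] is the end of the old interval that is extended and [b] the added position; they unify the
     two directions of growth. *)
  have [a [b [aS [bn [bS [ab [new SE]]]]]]] : exists a b, lo <= a <= hi /\
      b < #|V| /\ ~~ (lo <= b <= hi) /\ (b == a.+1) || (a == b.+1) /\
      (forall i, lo <= i <= hi -> (b == i.+1) || (i == b.+1) -> i = a) /\
      forall i, (lo' <= i <= hi') = (i == b) || (lo <= i <= hi).
    case: step => -[e1 e2]; [exists hi, hi' | exists lo, lo'];
      by repeat split; move=> *; lia.
  have [|x xa] := @layout_at _ k a; first lia.
  have [|y yb] := @layout_at _ k b; first lia.
  exists x, y; rewrite /linked !inE xa yb; split=> //.
  - by rewrite !SE eqxx aS ab orbT.
  - move=> z; rewrite inE => zS /and3P[_ _ H].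
    by apply: (@pos_inj _ k); rewrite xa; apply: new.
  - by apply/setP => z; rewrite !inE -(pos_eq k) yb SE.
have yx : y \notin component (interval_graph C lo hi) x.
  rewrite component_interval // (negbTE yS) andbF orbF.
  by apply: contraNneq yS => <-.
have compy : component (interval_graph C lo hi) y = [set y].
  apply/setP => z; rewrite component_interval // (negbTE yS) inE orbF.
  exact: eq_sym.
have compx : component (interval_graph C lo hi) x = block lo hi.
  apply/setP => z; rewrite component_interval // xS /=.
  by case: eqP => [<-|//]; rewrite xS.
have old u v : linked C lo hi u v -> linked C lo' hi' u v.
  by case/and3P => uS vS uv; rewrite /linked S' !in_setU1 uS vS !orbT.
have splitE u v : linked C lo' hi' u v ->
    [\/ linked C lo hi u v, u \in block lo hi /\ v = y
      | v \in block lo hi /\ u = y].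
  move=> uv; have := linked_neq uv; move: uv => /and3P[].
  rewrite S' !in_setU1 => /orP[/eqP->|uS] /orP[/eqP->|vS] uv.
  - by rewrite eqxx.
  - by constructor 3.
  - by constructor 2.
  - by constructor 1; rewrite /linked uS vS.
case: C yx compy compx old splitE => yx compy compx old splitE.
  exists x, y; split=> //; apply/setP => e.
  rewrite in_setU1; apply/interval_edgesP/orP; last first.
    move=> [/eqP->|/interval_edgesP[u [v [/old uv ->]]]]; first by exists x, y.
    by exists u, v.
  move=> [u [v [uv ->]]].
  have [uv'|[uS E]|[vS E]] := splitE _ _ uv.
  - by right; apply/interval_edgesP; exists u, v.
  - by left; move: uv; rewrite E => /(new _ uS)->.
  - by left; move: uv; rewrite E linked_sym => /(new _ vS)->; rewrite setUC.
exists x, y; split=> //; apply/setP => e.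
rewrite compx compy in_setU; apply/interval_edgesP/orP; last first.
  move=> [/interval_edgesP[u [v [/old uv ->]]]|/imset2P[u v uS]].
    by exists u, v.
  rewrite inE => /eqP-> ->; exists u, y; split=> //.
  rewrite /linked S' !in_setU1 eqxx uS orbT /=.
  by apply: contraNneq yS => <-.
move=> [u [v [uv ->]]].
have [uv'|[uS E]|[vS E]] := splitE _ _ uv.
- by left; apply/interval_edgesP; exists u, v.
- by right; apply/imset2P; exists u y; rewrite ?set11 ?E.
- by right; apply/imset2P; exists v y; rewrite ?set11 ?E // setUC.
Qed.

(** * MinLAs keep the interval contiguous *)

Definition contiguous p (S : {set V}) := forall z x y,
  z \notin S -> x \in S -> y \in S -> (pos p x < pos p z) = (pos p y < pos p z).

(** Two constants let the shift from [k] to [p] go either way in the natural numbers. *)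
Definition translates p (S : {set V}) := exists c d, forall x, x \in S ->
  pos p x + c = pos k x + d.

Lemma contiguousP p (S : {set V}) :
  (forall z x y, z \notin S -> x \in S -> y \in S -> pos p x < pos p z ->
     pos p z < pos p y -> False) -> contiguous p S.
Proof.
have np z x (zS : z \notin S) (xS : x \in S) : pos p z != pos p x.
  by rewrite pos_eq; apply: contraNneq zS => ->.
move=> H z x y zS xS yS; have := H z x y zS xS yS; have := H z y x zS yS xS.
have := np z x zS xS; have := np z y zS yS.
by case: ltnP => ? ? ? h1 h2; case: ltnP => // ?; [case: h2|case: h1]; lia.
Qed.

Lemma translates_contiguous p lo hi :
  translates p (block lo hi) -> contiguous p (block lo hi).
Proof.
move=> [c [d T]]; apply: contiguousP => z x y zS xS yS xz zy.
have Tx := T x xS; have Ty := T y yS.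
(* [w] is the node that the shift sends to the position of [z]; it lies between [x] and [y] in [k],
   hence in the block, so it would be [z]. *)
have [|w kw] := @layout_at _ k (pos p z + c - d).
  by have := pos_ltn k y; lia.
have wS : w \in block lo hi by move: xS yS; rewrite !inE kw; lia.
case/negP: zS; rewrite -(_ : w = z) //; apply: (@pos_inj _ p).
by have := T w wS; lia.
Qed.

(** Absolute difference: one of the two truncated terms is zero. *)
Definition gap p x y := (pos p y - pos p x) + (pos p x - pos p y).

(** Doubling gives a sum over ordered pairs, where the symmetry of [linked] removes the condition on
    which endpoint comes first. *)
Lemma arrangement_cost_double C lo hi p :
  (arrangement_cost (interval_graph C lo hi) p).*2 =
  \sum_x \sum_(y | linked C lo hi x y) gap p x y.
Proof.
pose h x y := if linked C lo hi x y then pos p y - pos p x else 0.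
have -> : arrangement_cost (interval_graph C lo hi) p = \sum_x \sum_y h x y.
  apply: eq_bigr => x _; rewrite big_mkcond; apply: eq_bigr => y _.
  rewrite adj_interval /h -/(pos p x) -/(pos p y).
  by case: (linked C lo hi x y) => //=; case: ifP; lia.
rewrite -addnn [X in _ + X]exchange_big /= -big_split; apply: eq_bigr => x _ /=.
rewrite -big_split [RHS]big_mkcond; apply: eq_bigr => y _ /=.
by rewrite /h [linked _ _ _ y x]linked_sym /gap; case: ifP.
Qed.

Lemma gap_gt0 p x y : x != y -> 0 < gap p x y.
Proof. by rewrite -(pos_eq p) /gap; lia. Qed.

Lemma line_cost_min lo hi p :
  (forall x y, linked LineInstances lo hi x y -> gap p x y = 1) ->
  minLA (interval_graph LineInstances lo hi) p.
Proof.
move=> H; apply/forallP => q; rewrite -leq_double !arrangement_cost_double.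
apply: leq_sum => x _; apply: leq_sum => y xy; rewrite H //.
exact/gap_gt0/linked_neq/xy.
Qed.

(** [k] gives every edge length 1, the least possible, so a layout with one longer edge would cost
    strictly more. *)
Lemma line_gap1 lo hi p x y :
  minLA (interval_graph LineInstances lo hi) p ->
  linked LineInstances lo hi x y -> gap p x y = 1.
Proof.
move=> /forallP/(_ k); rewrite -leq_double !arrangement_cost_double.
have -> : \sum_x \sum_(y | linked LineInstances lo hi x y) gap k x y =
   \sum_x \sum_(y | linked LineInstances lo hi x y) 1.
  apply: eq_bigr => u _; apply: eq_bigr => v /and3P[_ _]; rewrite /gap; lia.
rewrite !pair_big_dep /= => le xy; apply/eqP; rewrite eqn_leq.
rewrite gap_gt0 ?(linked_neq xy) // andbT leqNgt; apply: contraL le => lt.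
rewrite -ltnNge (bigD1 (x, y)) //= [X in _ < X](bigD1 (x, y)) //= -addSn.
apply: leq_add => //; apply: leq_sum => -[u v] /andP[uv _].
exact/gap_gt0/linked_neq/uv.
Qed.

(** Consecutive nodes of the path are adjacent in [p], so [z] is on the same side of both; this
    propagates along the path. *)
Lemma line_contiguous lo hi p : hi < #|V| ->
  minLA (interval_graph LineInstances lo hi) p -> contiguous p (block lo hi).
Proof.
move=> hin minp z x y zS.
wlog le : x y / pos k x <= pos k y => [W xS yS|].
  have [le|/ltnW le] := leqP (pos k x) (pos k y); first exact: W.
  by apply/esym/W.
have [n] := ubnP (pos k y - pos k x); elim: n x le => // n IH x le lt xS yS.
have [/eqP|ne] := eqVneq (pos k x) (pos k y); first by rewrite pos_eq => /eqP->.
have [|w pw] := @layout_at _ k (pos k x).+1; first by move: yS; rewrite inE; lia.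
have wS : w \in block lo hi by move: xS yS; rewrite !inE pw; lia.
rewrite -(IH w) //; try lia.
have nzS u : u \in block lo hi -> pos p z != pos p u.
  by move=> uS; rewrite pos_eq; apply: contraNneq zS => ->.
have := nzS w wS; have := nzS x xS.
have := line_gap1 minp (linked_succ LineInstances xS wS pw).
by rewrite /gap; lia.
Qed.

Definition rank p (S : {set V}) z := #|[set x in S | pos p x < pos p z]|.

(** The length of an edge counts the nodes [z] after its left end and up to its right end. After
    exchanging the sums, each [z] counts the pairs of a clique node strictly before it and one at or
    after it. *)
Lemma clique_cost_rank lo hi p (S := block lo hi) :
  arrangement_cost (interval_graph CliqueInstances lo hi) p =
  \sum_z rank p S z * (#|S| - rank p S z).
Proof.
pose h x y z := [&& x \in S, y \in S & pos p x < pos p z <= pos p y].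
transitivity (\sum_x \sum_y \sum_z h x y z).
  apply: eq_bigr => x _; rewrite big_mkcond; apply: eq_bigr => y _.
  rewrite adj_interval /linked -/(pos p x) -/(pos p y) -/S.
  have -> : (if [&& x \in S, y \in S & x != y] && (pos p x < pos p y) then
      pos p y - pos p x else 0) =
    if (x \in S) && (y \in S) then pos p y - pos p x else 0.
    rewrite -(pos_eq p); case: (x \in S) (y \in S) => -[] //=.
    by case: ifP; lia.
  case: ifP => xyS; last by rewrite big1 // => z _; rewrite /h andbA xyS.
  rewrite -subSS -(@card_pos_between _ p (pos p x).+1 (pos p y).+1) ?pos_ltn //.
  rewrite -sum1_card big_mkcond; apply: eq_bigr => z _ /=.
  by rewrite /h andbA xyS inE /= ltnS; case: ifP.
under eq_bigr do rewrite exchange_big.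
rewrite exchange_big; apply: eq_bigr => z _ /=.
have -> : #|S| - rank p S z = #|[set y in S | pos p z <= pos p y]|.
  rewrite -(cardsID [set x | pos p x < pos p z] S) /rank setIdE addKn.
  by apply: eq_card => y; rewrite in_setD !in_set -leqNgt andbC.
rewrite /rank -!sum1_card [X in X * _]big_mkcond [X in _ * X]big_mkcond /=.
rewrite big_distrl; apply: eq_bigr => x _; rewrite big_distrr.
apply: eq_bigr => y _; rewrite (in_set (fun x => _)) (in_set (fun x => _)) /h /=.
by case: (x \in S) (y \in S) (pos p x < _) (_ <= pos p y) => -[] [] [].
Qed.

(** Distinct members of [S] have distinct ranks below [#|S|], so every such value is taken exactly
    once. *)
Lemma sum_rank p (S : {set V}) (f : nat -> nat) :
  \sum_(z in S) f (rank p S z) = \sum_(0 <= j < #|S|) f j.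
Proof.
have mono x y : x \in S -> pos p x < pos p y -> rank p S x < rank p S y.
  move=> xS lt; apply/proper_card/properP; split.
    by apply/subsetP => u; rewrite !inE; lia.
  by exists x; rewrite !inE xS ?lt ?ltnn.
have inj : {in enum S &, injective (rank p S)}.
  move=> x y; rewrite !mem_enum => xS yS e; apply: (@pos_inj _ p).
  by have := mono x y xS; have := mono y x yS; lia.
rewrite -big_enum -(big_map (rank p S) xpredT f); apply: perm_big.
have us : uniq [seq rank p S z | z <- enum S].
  by rewrite map_inj_in_uniq ?enum_uniq.
apply: uniq_perm; rewrite ?iota_uniq //.
suff sub : {subset [seq rank p S z | z <- enum S] <= iota 0 (#|S| - 0)}.
  have [|_ E] := uniq_min_size us sub; last exact: E.
  by rewrite size_iota size_map -cardE subn0.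
move=> j /mapP[x]; rewrite mem_enum mem_iota subn0 add0n => xS -> /=.
apply/proper_card/properP; split.
  by apply/subsetP => u; rewrite inE; case/andP.
by exists x; rewrite // inE ltnn andbF.
Qed.

(** The first sum is the same for every layout, so only the contribution of the nodes outside the
    clique has to be minimized. *)
Lemma clique_cost lo hi p (S := block lo hi) :
  arrangement_cost (interval_graph CliqueInstances lo hi) p =
  \sum_(0 <= j < #|S|) j * (#|S| - j) +
  \sum_(z | z \notin S) rank p S z * (#|S| - rank p S z).
Proof.
rewrite clique_cost_rank -/S (bigID (mem S)) /=; congr (_ + _).
exact: (sum_rank p S (fun j => j * (#|S| - j))).
Qed.

Lemma contiguous_outer_cost p (S : {set V}) : contiguous p S ->
  \sum_(z | z \notin S) rank p S z * (#|S| - rank p S z) = 0.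
Proof.
move=> cS; apply: big1 => z zS; apply/eqP; rewrite muln_eq0 subn_eq0.
have [//|] := posnP (rank p S z); rewrite /rank => /card_gt0P[x].
rewrite in_set /= => /andP[xS xz]; apply/subset_leq_card/subsetP => y yS.
by rewrite inE yS -(cS z x y).
Qed.

(** [k] has outer cost 0, hence so has every MinLA; each outside node then has rank 0 or [#|S|],
    that is, lies before or after the whole clique. *)
Lemma clique_min_contiguous lo hi p :
  minLA (interval_graph CliqueInstances lo hi) p -> contiguous p (block lo hi).
Proof.
move=> /forallP/(_ k); rewrite !clique_cost.
rewrite (contiguous_outer_cost (p := k)); last first.
  by apply: translates_contiguous; exists 0, 0.
rewrite leq_add2l leqn0 sum_nat_eq0 => /forallP H.
apply: contiguousP => z x y zS xS yS xz zy.
have := H z; rewrite zS muln_eq0 /= => /orP[].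
  rewrite cards_eq0 => /eqP E; suff : x \in set0 by rewrite inE.
  by rewrite -E in_set xS xz.
rewrite subn_eq0 leqNgt => /negP[]; apply/proper_card/properP; split.
  by apply/subsetP => u; rewrite inE; case/andP.
by exists y => //; rewrite inE; lia.
Qed.

Lemma minLA_contiguous C lo hi p : hi < #|V| ->
  minLA (interval_graph C lo hi) p -> contiguous p (block lo hi).
Proof. by case: C => hin; [apply: line_contiguous | apply: clique_min_contiguous]. Qed.

(** A shift keeps path edges at length 1, and keeps a clique contiguous, so that its outer cost
    vanishes. *)
Lemma translates_minLA C lo hi p :
  translates p (block lo hi) -> minLA (interval_graph C lo hi) p.
Proof.
case: C => T.
  apply: line_cost_min => x y /and3P[xS yS]; case: T => c [d T].
  by have := T x xS; have := T y yS; rewrite /gap; lia.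
apply/forallP => q; rewrite !clique_cost contiguous_outer_cost ?addn0 ?leq_addr //.
exact: translates_contiguous.
Qed.

End Intervals.

(** * Rearranged layouts, left counts and sums *)

Lemma relayout (V : finType) (p : layout V) (f : nat -> nat) :
  (forall i, i < #|V| -> f i < #|V|) ->
  (forall i j, i < #|V| -> j < #|V| -> f i = f j -> i = j) ->
  exists q : layout V, forall x, pos q x = f (pos p x).
Proof.
move=> fn finj.
pose g := [ffun x => Ordinal (fn _ (pos_ltn p x))].
have gP : injectiveb g.
  apply/injectiveP => x y; rewrite !ffunE => -[/finj E].
  by apply: (@pos_inj _ p); apply: E; exact: pos_ltn.
by exists (Layout gP) => x; rewrite /pos /= ffunE.
Qed.

(* The numbers a = left_count t and b = t + 1 - a run through (1,0), (1,1),
   (1,2), (2,2), (3,2), (3,3), ...: the sign of a - b at even times alternates. *)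
Definition left_count t := t./2.+1 - (~~ odd t && odd t./2).

(** Up to time [(m.-1).*2] these bounds keep both counts at most [m]; the last clause says that one
    step adds one node on one side. *)
Lemma left_countE t : left_count t <= t.+1 /\ left_count t <= t./2.+1 /\
  t <= left_count t + t./2 /\
  (left_count t.+1 = left_count t \/ left_count t.+1 = (left_count t).+1).
Proof. by rewrite /left_count /=; lia. Qed.

Lemma left_count_double j : left_count j.*2 = j.+1 - odd j.
Proof. by rewrite /left_count; lia. Qed.

Lemma sum_odd l : \sum_(j < l) j.*2.+1 = l * l.
Proof. by elim: l => [|l IH]; rewrite ?big_ord0 // big_ord_recr /= IH; lia. Qed.

Lemma sum_pairs l (F : nat -> nat) :
  \sum_(i < l.*2) F i = \sum_(j < l) (F j.*2 + F j.*2.+1).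
Proof.
elim: l => [|l IH]; first by rewrite !big_ord0.
by rewrite doubleS !big_ord_recr /= IH addnA.
Qed.

Lemma ltn_sum_const (T : finType) (A : {set T}) (F : T -> nat) c x :
  x \in A -> c < F x -> (forall y, y \in A -> c <= F y) ->
  #|A| * c < \sum_(y in A) F y.
Proof.
move=> xA lt le; rewrite -sum_nat_const (bigD1 x xA) /= [X in _ < X](bigD1 x xA) /=.
rewrite -addSn leq_add // leq_sum // => y /andP[yA _]; exact: le.
Qed.

(** * The adversary: cost of the algorithm and of the optimum *)

Section Adversary.
Variables (V : finType) (p0 k : layout V) (m : nat) (C : instance_class).
Local Notation n := #|V|.
Hypotheses (m_gt0 : 0 < m) (le_2m : m.*2 <= n).

(* The initial layout consists of blocks [L], [M], [R] of sizes [m], [n - 2m]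
   and [m]; the layout [k] is [L], [R], [M]. *)
Hypothesis kE : forall x, pos k x =
  if pos p0 x < m then pos p0 x
  else if pos p0 x < n - m then pos p0 x + m else pos p0 x - (n - m.*2).

(** In [k] the blocks L and R meet at position [m]; for [t <= (m.-1).*2], the [t.+1] positions from
    [first t] on hold [left_count t] nodes of L and otherwise nodes of R. *)
Definition first t := m - left_count t.
Definition revealed t := block k (first t) (first t + t).
Definition middle : {set V} := [set x | m <= pos p0 x < n - m].

Definition adversary := Instance p0 (m.-1).*2
  (fun t => interval_graph k C (first t) (first t + t)).

Lemma first_lt t : t <= (m.-1).*2 -> first t + t < m.*2.
Proof. by rewrite /first; have := left_countE t; lia. Qed.

Lemma adversary_in_class : in_class C adversary.
Proof.
have hin t : t <= (m.-1).*2 -> first t + t < n by move=> /first_lt; lia.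
split=> [|t /hin|t lt].
(* At time 0 the interval is a single position, which links no two distinct nodes. *)
- apply/eqP; rewrite -subset0; apply/subsetP => e /interval_edgesP[x [y [xy _]]].
  have := linked_neq xy; move: xy; rewrite /linked !inE -(pos_eq k).
  by move=> /and3P[] *; lia.
- exact: interval_graph_shape.
- have ltn := hin t (ltnW lt); have ltn' := hin t.+1 lt; rewrite /= in lt *.
  apply: interval_graph_step; rewrite ?ltn' ?leq_addr ?ltn //.
  by rewrite /first; have := left_countE t; have := left_countE t.+1; lia.
Qed.

Lemma in_revealed t x : t <= (m.-1).*2 -> x \in revealed t =
  (m - left_count t <= pos p0 x < m) ||
  (n - m <= pos p0 x < n - m + (t.+1 - left_count t)).
Proof.
move=> le; have := pos_ltn p0 x; have := left_countE t; rewrite inE kE /first.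
by case: ifP; [|case: ifP]; lia.
Qed.

Lemma card_middle : #|middle| = n - m.*2.
Proof. by rewrite card_pos_between; lia. Qed.

(** The order is L, the first [b] nodes of R, M, the rest of R: only pairs of M with these [b] nodes
    are inverted. *)
Lemma right_layout b : b <= m -> exists q,
  [/\ forall x, pos p0 x < m \/ n - m <= pos p0 x < n - m + b -> pos q x = pos k x
    & inversions p0 q <= #|middle| * b].
Proof.
move=> bm.
pose f i := if i < m then i else if i < n - m then i + b
  else if i < n - m + b then i - (n - m.*2) else i.
have [||q qE] := @relayout V p0 f.
- by move=> i; rewrite /f; repeat case: ifP => ?; lia.
- by move=> i j ? ?; rewrite /f; repeat case: ifP => ?; lia.
exists q; split.
  by move=> x H; rewrite qE kE /f; repeat case: ifP => ?; lia.
have <- : #|[set x | n - m <= pos p0 x < n - m + b]| = b.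
  by rewrite card_pos_between; lia.
rewrite -cardsX; apply/subset_leq_card/subsetP => -[x y].
by rewrite !inE !qE /f /=; repeat case: ifP => ?; lia.
Qed.

(** Symmetrically, the last [a] nodes of L jump over M. *)
Lemma left_layout a : a <= m -> exists q,
  [/\ forall x, m - a <= pos p0 x < m \/ n - m <= pos p0 x ->
        pos q x = pos k x + (n - m.*2)
    & inversions p0 q <= #|middle| * a].
Proof.
move=> am.
pose f i := if i < m - a then i else if i < m then i + (n - m.*2)
  else if i < n - m then i - a else i.
have [||q qE] := @relayout V p0 f.
- by move=> i; rewrite /f; repeat case: ifP => ?; lia.
- by move=> i j ? ?; rewrite /f; repeat case: ifP => ?; lia.
exists q; split.
  by move=> x H; have := pos_ltn p0 x; rewrite qE kE /f; repeat case: ifP => ?; lia.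
have <- : #|[set x | m - a <= pos p0 x < m]| = a.
  by rewrite card_pos_between; lia.
rewrite mulnC -cardsX; apply/subset_leq_card/subsetP => -[x y].
by have := pos_ltn p0 x; have := pos_ltn p0 y;
  rewrite !inE !qE /f /=; repeat case: ifP => ?; lia.
Qed.

Definition closest t p :=
  minLA (interval_graph k C (first t) (first t + t)) p /\
  forall q, minLA (interval_graph k C (first t) (first t + t)) q ->
    kendall_tau p0 p <= kendall_tau p0 q.

(** Parity encodes the side: M precedes the interval for odd [j] and follows it for even [j]. *)
Definition on_side j p := forall x y, x \in middle -> y \in revealed j.*2 ->
  (pos p x < pos p y) = odd j.

(** The interval has [a] nodes from L and [b] from R, and [c] is their minimum. An explicit MinLA
    bounds the inversions by [c] per node of M, while every node of M needs at least [c]; so none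
    can be on the side that needs [c.+1]. *)
Lemma closest_on_side j p : j < m -> closest j.*2 p -> on_side j p.
Proof.
move=> jm [minp clp]; set t := j.*2.
have tm : t <= (m.-1).*2 by rewrite /t; lia.
have ac : left_count t = j.+1 - odd j by exact: left_count_double.
pose a := j.+1 - odd j; pose b := j + odd j; pose c := if odd j then a else b.
have cont : contiguous p (revealed t).
  by apply: minLA_contiguous minp; exact: leq_trans (first_lt tm) le_2m.
have mid x : x \in middle -> x \notin revealed t.
  by rewrite in_revealed // inE; lia.
have le : inversions p0 p <= #|middle| * c.
  rewrite -kendall_tauE.
  have [q lq /clp le] : exists2 q, inversions p0 q <= #|middle| * c &
      minLA (interval_graph k C (first t) (first t + t)) q.
    (* For odd [j], [a < b] and M goes to the left of the interval; for even [j], [b < a] and it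
       goes to the right. *)
    rewrite /c; case: ifP => oj.
      have [|q [qE qi]] := @left_layout a; first by rewrite /a; lia.
      exists q => //; apply: translates_minLA; exists 0, (n - m.*2) => x.
      rewrite -/(revealed t) in_revealed // ac => H; rewrite addn0 qE //.
      by rewrite /a; lia.
    have [|q [qE qi]] := @right_layout b; first by rewrite /b; lia.
    exists q => //; apply: translates_minLA; exists 0, 0 => x.
    rewrite -/(revealed t) in_revealed // ac => H; rewrite !addn0 qE //.
    by move: H; rewrite /b /t; lia.
  by apply: leq_trans le _; rewrite kendall_tauE.
pose A := [set x | m - a <= pos p0 x < m].
pose B := [set x | n - m <= pos p0 x < n - m + b].
have cA : #|A| = a by rewrite card_pos_between /a; lia.
have cB : #|B| = b by rewrite card_pos_between /b; lia.
pose F x := #|[set y in revealed t | (pos p0 x < pos p0 y) != (pos p x < pos p y)]|.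
have disj : [disjoint middle & revealed t].
  by apply/pred0P => x /=; apply/negP => /andP[/mid/negP].
have := leq_trans (inversions_disjoint p0 p disj) le; rewrite -/F leqNgt => nlt.
have inS y : (y \in revealed t) = (y \in A) || (y \in B).
  by rewrite in_revealed // ac !inE /a /b /t; lia.
have neq x y : x \in middle -> y \in revealed t -> pos p x != pos p y.
  by move=> xM yS; rewrite pos_eq; apply: contraNneq (mid x xM) => ->.
have FA x y : x \in middle -> y \in revealed t -> pos p x < pos p y -> a <= F x.
  move=> xM yS xy; rewrite -cA; apply/subset_leq_card/subsetP => z zA.
  have zS : z \in revealed t by rewrite inS zA.
  rewrite in_set zS /=; have := cont x y z (mid x xM) yS zS; have := neq x z xM zS.
  by move: xM zA; rewrite !inE; lia.
have FB x y : x \in middle -> y \in revealed t -> pos p y < pos p x -> b <= F x.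
  move=> xM yS xy; rewrite -cB; apply/subset_leq_card/subsetP => z zB.
  have zS : z \in revealed t by rewrite inS zB orbT.
  rewrite in_set zS /=; have := cont x y z (mid x xM) yS zS; have := neq x z xM zS.
  by move: xM zB; rewrite !inE; lia.
move=> x y xM yS.
have Fc z : z \in middle -> c <= F z.
  move=> zM; have := neq z y zM yS; case: (ltngtP (pos p z) (pos p y)) => // H _.
    by apply: leq_trans _ (FA z y zM yS H); rewrite /c /a /b; case: ifP; lia.
  by apply: leq_trans _ (FB z y zM yS H); rewrite /c /a /b; case: ifP; lia.
(* A node of M on the wrong side has [F x > c], which pushes the sum above the bound in [nlt]. *)
apply/idP/idP => H; apply: contraR nlt => nH; apply: (ltn_sum_const xM _ Fc).
  apply: leq_trans _ (FA x y xM yS H).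
  by rewrite /c /a /b (negbTE nH); lia.
apply: leq_trans _ (FB x y xM yS _); first by rewrite /c /a /b H; lia.
by have := neq x y xM yS; lia.
Qed.

(** The interval only grows, so all of M changes sides with respect to all [j.*2.+1] nodes of the
    earlier interval. *)
Lemma on_side_move j p q : j.+1 < m -> on_side j p -> on_side j.+1 q ->
  #|middle| * j.*2.+1 <= inversions p q.
Proof.
move=> jm sp sq; set S := revealed j.*2.
have tm : j.*2 <= (m.-1).*2 by lia.
have sub y : y \in S -> y \in revealed j.+1.*2.
  by rewrite !in_revealed ?left_count_double //=; lia.
have cS : #|S| = j.*2.+1.
  have <- : #|[set x | first j.*2 <= pos k x < (first j.*2 + j.*2).+1]| = j.*2.+1.
    by rewrite card_pos_between; have := first_lt tm; lia.
  by apply: eq_card => x; rewrite !inE.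
rewrite -cS -sum_nat_const.
have disj : [disjoint middle & S].
  by apply/pred0P => x /=; rewrite in_revealed // inE; lia.
apply: leq_trans (inversions_disjoint p q disj); apply: leq_sum => x xM.
apply/subset_leq_card/subsetP => y yS; rewrite in_set yS /=.
by rewrite (sp x y xM yS) (sq x y xM (sub y yS)) /=; case: (odd j).
Qed.

Lemma on_side_init : on_side 0 p0.
Proof.
by move=> x y; rewrite in_revealed // left_count_double inE /=; lia.
Qed.

(** The two steps from time [j.*2] make M cross [j.*2.+1] nodes, and these odd numbers add up to the
    square of [m.-1]. *)
Lemma adversary_cost (A : online_algorithm V) : always_closest_to_init C A ->
  (n - m.*2) * (m.-1 * m.-1) <= solution_cost (run A adversary).
Proof.
move=> /(_ _ adversary_in_class) closeA.
set s := run A adversary; pose P i := nth p0 (p0 :: s) i.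
have side j : j < m -> on_side j (P j.*2).
  case: j => [_|j jm]; first exact: on_side_init.
  (* The initial layout is entry 0 of [P], so the layout at time [j.+1.*2] is entry [j.*2.+1] of
     [s]. *)
  have lt : j.*2.+1 < (m.-1).*2 by lia.
  apply: closest_on_side => //; have := closeA (Ordinal lt).
  by rewrite (tnth_nth p0).
have -> : solution_cost s = \sum_(i < (m.-1).*2) inversions (P i) (P i.+1).
  by apply: eq_bigr => i _; rewrite kendall_tauE (tnth_nth p0).
rewrite (sum_pairs _ (fun i => inversions (P i) (P i.+1))) -sum_odd big_distrr.
apply: leq_sum => j _; apply: leq_trans (inversions_triangle _ _ _).
have jm := ltn_ord j; rewrite -card_middle.
by apply: on_side_move; rewrite -?doubleS; try apply: side; lia.
Qed.

(** The order L, R, M agrees with [k] on every revealed interval, so it stays a MinLA throughout and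
    only the first step costs. *)
Lemma adversary_opt : opt adversary <= (n - m.*2) * m.
Proof.
rewrite /opt; case: ex_minnP => c _ minc.
have [q [qE qi]] := right_layout (leqnn m).
pose s := [tuple of nseq (m.-1).*2 q].
apply: (@leq_trans (@solution_cost V adversary s)).
  apply: minc; apply/existsP; exists s; rewrite eqxx andbT.
  apply/forallP => i; rewrite (tnth_nth q) nth_nseq ltn_ord /=.
  apply: translates_minLA; exists 0, 0 => x; rewrite -/(revealed _).
  rewrite in_revealed ?ltn_ord // => H; rewrite !addn0 qE //.
  by have := pos_ltn p0 x; move: H; case/orP; lia.
rewrite /solution_cost -card_middle /= /s; case: (m.-1).*2 => [|l].
  by rewrite big_ord0.
rewrite big_ord_recl big1 => [|i _].
  by rewrite addn0 (tnth_nth q) /= kendall_tauE.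
rewrite (tnth_nth q) /= nth_nseq if_same kendall_tauE.
rewrite (_ : nth _ _ _ = q) ?inversions_self //.
by rewrite (nth_nseq p0 l.+1 q (0 + i)) leqW // add0n ltn_ord.
Qed.

End Adversary.

(** * The competitive ratio *)

Import Order.TTheory GRing.Theory Num.Theory.
Local Open Scope ring_scope.

Theorem theorem16 (R : realType) (C : instance_class) :
  exists (gamma : R) (n0 : nat), 0 < gamma /\
    forall (n : nat) (V : finType) (A : online_algorithm V) (c : R),
      (n0 <= n)%N -> #|V| = n ->
      always_closest_to_init C A ->
      competitive C c A ->
      gamma * n%:R <= c.
Proof.
(* [n >= 9] gives [m >= 3]; with [n <= m * 4] this makes [n * m] at most 12 times the square of
   [m.-1], the inequality that closes the proof. *)
exists 12%:R^-1, 9%N; split; first by rewrite invr_gt0 ltr0n.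
move=> n V A c le9 cV closeA compA; pose m := (n %/ 3)%N.
have m3 : (3 <= m)%N by rewrite /m; lia.
have mn : (m * 3 <= n <= m * 4)%N by rewrite /m; lia.
have [p0 _] : exists p : layout V, true.
  have inj : injectiveb [ffun x : V => enum_rank x].
    by apply/injectiveP => x y; rewrite !ffunE => /enum_rank_inj.
  by exists (Layout inj).
have [||k kE] := @relayout V p0 (fun i => if i < m then i
    else if i < #|V| - m then i + m else i - (#|V| - m.*2))%N.
- by move=> i; rewrite cV; repeat case: ifP => ?; lia.
- by move=> i j; rewrite cV; repeat case: ifP => ?; lia.
have m_gt0 : (0 < m)%N by lia.
have le_2m : (m.*2 <= #|V|)%N by rewrite cV; lia.
have cost := adversary_cost m_gt0 le_2m kE closeA.
have optle := adversary_opt C m_gt0 le_2m kE.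
have := compA _ (adversary_in_class p0 k C m_gt0 le_2m).
set M := (#|V| - m.*2)%N in cost optle; have M0 : (0 < M)%N by rewrite /M cV; lia.
set s := solution_cost _ in cost *; set o := opt _ in optle * => le.
have s0 : (0 < s)%N by apply: leq_trans cost; rewrite !muln_gt0 M0; lia.
(* A negative [c] would contradict the positive cost; nonnegativity permits replacing the optimum by
   its upper bound. *)
have c0 : 0 <= c.
  rewrite leNgt; apply/negP => c0; have : s%:R <= 0 :> R.
    by apply: le_trans le _; rewrite mulr_le0_ge0 // ltW.
  by rewrite lern0; lia.
have : (M * (m.-1 * m.-1))%:R <= c * (M * m)%:R.
  apply: le_trans (_ : s%:R <= _); first by rewrite ler_nat.
  by apply: le_trans le _; rewrite ler_wpM2l // ler_nat.
(* The factor [M] cancels, so [c * m] is at least the square of [m.-1]. *)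
rewrite !(natrM _ M) mulrCA ler_pM2l ?ltr0n // => H.
rewrite -(ler_pM2r (_ : 0 < m%:R)) ?ltr0n //; apply: le_trans H.
rewrite -mulrA ler_pdivrMl ?ltr0n // -!natrM ler_nat.
by nia.
Qed.
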